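(* Let $H$ be a real Hilbert space with $\dim H\ge2$, and let $G\subset H$ be an open set containing the origin. Suppose that for every real two-dimensional linear subspace $\Lambda\subset H$ there is a number $r_\Lambda>0$ such that $$G\cap\Lambda=\{x\in\Lambda:|x|<r_\Lambda\}.$$ Then all the radii $r_\Lambda$ are equal and $G$ is an open Hilbert ball centered at the origin, i.e. $G=\{x\in H:|x|<R\}$ for some $R>0$.
   Context: $|\cdot|$ denotes the Hilbert norm of $H$. *)

(* Defs.v *)
From HB Require Import structures.
From mathcomp Require Import all_boot all_order all_algebra.
From mathcomp Require Import all_classical all_reals all_analysis.

Set Implicit Arguments.
Unset Strict Implicit.
Unset Printing Implicit Defensive.

Import Order.TTheory GRing.Theory Num.Theory.
Import numFieldNormedType.Exports.

Local Open Scope classical_set_scope.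
Local Open Scope ring_scope.

(* A real Hilbert space is a complete normed module [H] over a real type [R]
   whose norm is the one induced by an inner product [ip]. *)
Definition hilbert_norm (R : realType) (H : completeNormedModType R)
    (ip : {dot H for idfun}) : Prop :=
  forall x : H, `|x| = Num.sqrt (ip x x).

Definition lin_comb (R : realType) (V : lmodType R) (n : nat)
    (e : 'I_n -> V) (c : 'I_n -> R) : V :=
  \sum_(i < n) c i *: e i.

Definition lin_indep (R : realType) (V : lmodType R) (n : nat)
    (e : 'I_n -> V) : Prop :=
  forall c : 'I_n -> R, lin_comb e c = 0 -> forall i, c i = 0.

(* [V] may be infinite-dimensional, so [{vspace V}] is not available. *)
Definition dim_ge (R : realType) (V : lmodType R) (n : nat) : Prop :=
  exists e : 'I_n -> V, lin_indep e.

Definition subspace_of_dim (R : realType) (V : lmodType R) (n : nat)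
    (L : set V) : Prop :=
  exists e : 'I_n -> V, lin_indep e /\ L = range (lin_comb e).

Definition disc_radius (R : realType) (H : normedModType R)
    (G L : set H) (r : R) : Prop :=
  0 < r /\ G `&` L = [set x | L x /\ `|x| < r].

(* Main.v *)
Require Import Defs.
From HB Require Import structures.
From mathcomp Require Import all_boot all_order all_algebra.
From mathcomp Require Import all_classical all_reals all_analysis.
Import Order.TTheory GRing.Theory Num.Theory.
Import numFieldNormedType.Exports.
Local Open Scope classical_set_scope.
Local Open Scope ring_scope.

Set Implicit Arguments.
Unset Strict Implicit.

(** A nonzero vector can be rescaled to any prescribed positive norm, so two
    planes that share a line cut [G] in discs of the same radius
    ([disc_radius_meet]): otherwise a vector of that line whose norm is the
    smaller radius would lie in one disc and outside the other. Two arbitrary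
    planes need not share a line, but a third plane through a nonzero vector of
    each of them shares a line with both ([plane_through]), so all radii agree.
    Every nonzero vector lies on some plane, hence its membership in [G] is
    decided by comparing its norm with the common radius. *)

Lemma lin_comb2 (R : realType) (V : lmodType R) (e : 'I_2 -> V)
    (c : 'I_2 -> R) :
  lin_comb e c = c ord0 *: e ord0 + c ord_max *: e ord_max.
Proof.
rewrite /lin_comb big_ord_recr big_ord1 /=.
by have -> : widen_ord (leqnSn 1) ord0 = ord0 :> 'I_2 by exact: val_inj.
Qed.

Lemma lin_indep_neq0 (R : realType) (V : lmodType R) (n : nat)
    (e : 'I_n -> V) (i : 'I_n) : lin_indep e -> e i != 0.
Proof.
move=> indep; apply/eqP => ei0.
have /indep/(_ i)/eqP : lin_comb e (fun j => (j == i)%:R) = 0.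
  rewrite /lin_comb big1// => j _.
  by case: eqVneq => [->|_]; rewrite ?ei0 ?scaler0 ?scale0r.
by rewrite eqxx oner_eq0.
Qed.

Lemma mem_range_lin_comb (R : realType) (V : lmodType R) (n : nat)
    (e : 'I_n -> V) (i : 'I_n) : range (lin_comb e) (e i).
Proof.
exists (fun j => (j == i)%:R) => //.
rewrite /lin_comb (bigD1 i)//= eqxx scale1r big1 ?addr0// => j /negPf ->.
by rewrite scale0r.
Qed.

Lemma subspace_scale (R : realType) (V : lmodType R) (n : nat) (L : set V)
    (k : R) (x : V) : subspace_of_dim n L -> L x -> L (k *: x).
Proof.
move=> [e [_ ->]] [c _ <-]; exists (fun i => k * c i) => //.
by rewrite /lin_comb scaler_sumr; apply: eq_bigr => i _; rewrite scalerA.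
Qed.

Lemma plane_neq0 (R : realType) (V : lmodType R) (L : set V) :
  subspace_of_dim 2 L -> exists2 x, L x & x != 0.
Proof.
move=> [e [indep ->]]; exists (e ord0); first exact: mem_range_lin_comb.
exact: lin_indep_neq0.
Qed.

(** A space of dimension at least two is not a line: two multiples of [u]
    always satisfy a nontrivial linear relation. *)
Lemma dim_ge2_off_line (R : realType) (V : lmodType R) (u : V) :
  dim_ge V 2 -> exists v : V, forall k : R, v <> k *: u.
Proof.
move=> [e indep]; apply: contrapT => /forallNP online.
have line v : exists k : R, v = k *: u.
  by apply: contrapT => /forallNP /online.
have [a ea] := line (e ord0); have [b eb] := line (e ord_max).
have /indep/(_ ord_max) : lin_comb e (fun i => if i == ord0 then b else - a) = 0.
  by rewrite lin_comb2 /= ea eb !scalerA mulNr (mulrC a) scaleNr subrr.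
move=> /= /eqP; rewrite oppr_eq0 => /eqP a0.
by have := lin_indep_neq0 ord0 indep; rewrite ea a0 scale0r eqxx.
Qed.

Lemma plane_span2 (R : realType) (V : lmodType R) (u v : V) :
  u != 0 -> (forall k : R, v <> k *: u) ->
  exists L : set V, [/\ subspace_of_dim 2 L, L u & L v].
Proof.
move=> u0 off; pose e (i : 'I_2) := if i == ord0 then u else v.
exists (range (lin_comb e)); split.
- exists e; split=> // c; rewrite lin_comb2 /e /= => rel.
  have c1 : c ord_max = 0.
    apply/eqP/negPn/negP => c1; apply: (off (- (c ord_max)^-1 * c ord0)).
    apply: (scalerI c1); rewrite scalerA mulNr mulrN mulVKf// scaleNr.
    by apply/eqP; rewrite -addr_eq0 addrC rel.
  move: rel; rewrite c1 scale0r addr0 => /eqP.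
  rewrite scaler_eq0 (negPf u0) orbF => /eqP c0 i.
  case: (eqVneq i ord0) => [->//|i0].
  suff -> : i = ord_max by [].
  by apply: val_inj; case: i i0 => [[|[|]]].
- exact: (mem_range_lin_comb e ord0).
- exact: (mem_range_lin_comb e ord_max).
Qed.

(** If [y] is a multiple of [u], any plane containing [u] will do, and
    [dim_ge2_off_line] supplies a second direction for it. *)
Lemma plane_through (R : realType) (V : lmodType R) (u y : V) :
  dim_ge V 2 -> u != 0 ->
  exists L : set V, [/\ subspace_of_dim 2 L, L u & L y].
Proof.
move=> dimV u0; have [[k ->]|/forallNP off] := pselect (exists k : R, y = k *: u).
  have [v off] := dim_ge2_off_line u dimV.
  have [L [dL Lu _]] := plane_span2 u0 off.
  by exists L; split=> //; exact: subspace_scale dL Lu.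
exact: plane_span2.
Qed.

Lemma disc_radiusP (R : realType) (H : normedModType R) (G L : set H) (r : R)
    (x : H) : disc_radius G L r -> L x -> G x <-> `|x| < r.
Proof.
move=> [_ GL] Lx; split=> [Gx|xr].
  by have : (G `&` L) x by []; rewrite GL => -[].
by have : [set x | L x /\ `|x| < r] x by []; rewrite -GL => -[].
Qed.

Lemma disc_radius_meet_le (R : realType) (H : normedModType R) (n m : nat)
    (G L L' : set H) (r r' : R) (x : H) :
  subspace_of_dim n L -> subspace_of_dim m L' ->
  disc_radius G L r -> disc_radius G L' r' ->
  x != 0 -> L x -> L' x -> r' <= r.
Proof.
move=> dL dL' Gr Gr' x0 Lx L'x; rewrite leNgt; apply/negP => rr'.
pose k := r / `|x|.
have normk : `|k *: x| = r.
  by rewrite normrZ gtr0_norm ?divr_gt0 ?normr_gt0 ?(proj1 Gr)// divfK// normr_eq0.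
have /(disc_radiusP Gr') : L' (k *: x) by exact: subspace_scale dL' L'x.
have /(disc_radiusP Gr) -> : L (k *: x) by exact: subspace_scale dL Lx.
by rewrite normk ltxx rr' => -[_ /(_ isT)].
Qed.

Lemma disc_radius_meet (R : realType) (H : normedModType R) (n m : nat)
    (G L L' : set H) (r r' : R) (x : H) :
  subspace_of_dim n L -> subspace_of_dim m L' ->
  disc_radius G L r -> disc_radius G L' r' ->
  x != 0 -> L x -> L' x -> r = r'.
Proof.
move=> dL dL' Gr Gr' x0 Lx L'x; apply: le_anti; apply/andP; split.
  exact: (disc_radius_meet_le dL' dL Gr' Gr x0 L'x Lx).
exact: (disc_radius_meet_le dL dL' Gr Gr' x0 Lx L'x).
Qed.

Unset Implicit Arguments.
Set Strict Implicit.

Theorem theorem4p9 (R : realType) (H : completeNormedModType R)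
    (ip : {dot H for idfun}) (ip_norm : hilbert_norm ip)
    (dimH : dim_ge H 2)
    (G : set H) (G_open : open G) (G0 : G 0)
    (G_discs : forall L : set H, subspace_of_dim 2 L ->
       exists r : R, disc_radius G L r) :
  (forall (L L' : set H) (r r' : R),
     subspace_of_dim 2 L -> subspace_of_dim 2 L' ->
     disc_radius G L r -> disc_radius G L' r' -> r = r') /\
  (exists rho : R, 0 < rho /\ G = [set x : H | `|x| < rho]).
Proof.
have radius_eq (L L' : set H) (r r' : R) :
    subspace_of_dim 2 L -> subspace_of_dim 2 L' ->
    disc_radius G L r -> disc_radius G L' r' -> r = r'.
  move=> dL dL' Gr Gr'.
  have [x Lx x0] := plane_neq0 dL; have [y L'y y0] := plane_neq0 dL'.
  have [M [dM Mx My]] := plane_through y dimH x0.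
  have [s Gs] := G_discs M dM.
  rewrite (disc_radius_meet dL dM Gr Gs x0 Lx Mx).
  exact: (disc_radius_meet dM dL' Gs Gr' y0 My L'y).
split=> //.
have [e indep] := dimH; have dP : subspace_of_dim 2 (range (lin_comb e)).
  by exists e.
have [rho Grho] := G_discs _ dP; have rho0 : 0 < rho := proj1 Grho.
exists rho; split=> //; apply/seteqP.
have mem (x : H) : G x <-> `|x| < rho.
  have [->|x0] := eqVneq x 0; first by rewrite normr0.
  have [L [dL Lx _]] := plane_through x dimH x0.
  have [r Gr] := G_discs L dL.
  rewrite -(radius_eq _ _ _ _ dL dP Gr Grho).
  exact: disc_radiusP Gr Lx.
by split=> x /mem.
Qed.
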